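(* Let $n\ge1$. In the case $\mathbf{a}=(a_{1/2},0,a_{5/2})$, $$\prod_{i=1}^n\left(a_{1/2}(x_i^{1/2}+x_i^{-1/2})+a_{5/2}(x_i^{5/2}+x_i^{-5/2})\right)=\sum_{p=0}^n\sum_{q=0}^{n-p}a_{5/2}^p\,\psi_{q,r}(\mathbf{a})\,\mathrm{ch}^{SO(2n+1)}_{((5/2)^p,(3/2)^q,(1/2)^r)}(\mathbf{x},\overline{\mathbf{x}},1),$$ where $n=p+q+r$ and $$\psi_{q,r}(\mathbf{a})=\chi_{q,r}-a_{5/2}^2\,\chi_{q,r-2}+\sum_{s=2}^r\eta_s\,a_{1/2}\,a_{5/2}^{s-1}\,\chi_{q,r-s}+\zeta_r\,a_{5/2}^{r+1}\,\chi_{q-1,0}+\omega_r\,a_{5/2}^{r+2}\,\chi_{q-2,0},$$ with $$\eta_s=\begin{cases}1&s\equiv0,2\bmod5\\-1&s\equiv3,4\bmod5\\0&\text{otherwise}\end{cases},\quad \zeta_r=\begin{cases}1&r\equiv1\bmod5\\-1&r\equiv0\bmod5\\0&\text{otherwise}\end{cases},\quad \omega_r=\begin{cases}1&r\equiv2\bmod5\\-1&r\equiv3\bmod5\\0&\text{otherwise}\end{cases},$$ and $$\chi_{q,r}=\chi_{q,r}(\mathbf{a})=Q_qR_r+\sum_{s=1}^r\left(\sigma_s\,a_{1/2}\,a_{5/2}^s\,Q_{q-1}R_{r-s}+\tau_s\,a_{1/2}\,a_{5/2}^{s+1}\,Q_{q-2}R_{r-s}\right)-a_{5/2}^4\,Q_{q-3}R_{r-1},$$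 where $$\sigma_s=\begin{cases}1&s\equiv3\bmod5\\-1&s\equiv1\bmod5\\0&\text{otherwise}\end{cases},\qquad \tau_s=\begin{cases}1&s\equiv3\bmod5\\-1&s\equiv0\bmod5\\0&\text{otherwise}\end{cases}.$$ Here $Q_q=0$ for $q<0$ and $R_r=0$ for $r<0$, while $$Q_0=1,\qquad Q_q=-a_{1/2}a_{5/2}\,Q_{q-2}+a_{1/2}a_{5/2}^2\,Q_{q-3}+a_{5/2}^5\,Q_{q-5}\quad\text{if } q>0,$$ $$R_0=1,\qquad R_r=a_{1/2}R_{r-1}-a_{1/2}a_{5/2}^3R_{r-4}+a_{5/2}^5R_{r-5}+\sum_{s=3}^r\rho_s\,a_{1/2}^2\,a_{5/2}^{s-2}\,R_{r-s}\quad\text{if } r>0,$$ where $$\rho_s=\begin{cases}1&s\equiv2,3\bmod5\\-2&s\equiv0\bmod5\\0&\text{otherwise}\end{cases}.$$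
   Context: $\mathbf{x}=(x_1,\dots,x_n)$ are indeterminates (with formal square roots $x_i^{1/2}$), $\overline{\mathbf{x}}=(x_1^{-1},\dots,x_n^{-1})$; $a_{1/2},a_{5/2}$ are arbitrary scalar parameters; empty sums are $0$. $((5/2)^p,(3/2)^q,(1/2)^r)$ is the weight with $p$ components $5/2$, then $q$ components $3/2$, then $r$ components $1/2$. $\mathrm{ch}^{SO(2n+1)}_\lambda(\mathbf{x},\overline{\mathbf{x}},1)$ is the (spin) character of the irreducible representation (of the spin covering group) of $SO(2n+1)$ of highest weight $\lambda$, restricted to elements with eigenvalues $(\mathbf{x},\overline{\mathbf{x}},1)$; it is given by Weyl's formula $\sum_w\mathrm{sgn}(w)\mathbf{x}^{w(\lambda+\rho)}/\sum_w\mathrm{sgn}(w)\mathbf{x}^{w(\rho)}$ with $w$ running over all permutations and sign changes of the $n$ coordinates, $\mathrm{sgn}(w)$ the determinant of $w$, and $\rho=(n-\tfrac12,n-\tfrac32,\dots,\tfrac12)$ (this Weyl vector is unrelated to the numbers $\rho_s$ in the claim). *)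

(* Defs.v *)
From HB Require Import structures.
From mathcomp Require Import all_boot all_order all_fingroup all_algebra.
From mathcomp Require Import mpoly.

Set Implicit Arguments.
Unset Strict Implicit.
Unset Printing Implicit Defensive.

Import GRing.Theory.
Local Open Scope ring_scope.

(* Weights have half-integral coordinates.  They are stored doubled, as column
   vectors over int, and monomials are written in the formal square roots
   y_i = x_i^(1/2): with m = 2 mu, the monomial x^mu is \prod_i y_i ^ m_i. *)

(* The hyperoctahedral group: (s, e) acts by the signed permutation matrix
   with entry (-1)^(e i) in position (i, s i). *)
Definition hyperoct (n : nat) : finType := ({perm 'I_n} * {ffun 'I_n -> bool})%type.

Definition hyperoct_mx (n : nat) (w : hyperoct n) : 'M[int]_n :=
  \matrix_(i, j) ((-1) ^+ (w.2 i) * (w.1 i == j)%:R).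

Definition monomial (F : fieldType) (n : nat) (y : 'I_n -> F) (m : 'cV[int]_n) : F :=
  \prod_(i < n) y i ^ m i 0.

Definition alternant (F : fieldType) (n : nat) (y : 'I_n -> F) (m : 'cV[int]_n) : F :=
  \sum_(w : hyperoct n)
     (\det (hyperoct_mx w))%:~R * monomial y (hyperoct_mx w *m m).

(* 2 rho = (2n - 1, 2n - 3, ..., 1) *)
Definition weyl_vector2 (n : nat) : 'cV[int]_n :=
  \col_(i < n) (2 * (n%:Z - (i : nat)%:Z) - 1).

(* Weyl's formula, for the highest weight lam2 / 2. *)
Definition ch_SO_odd (F : fieldType) (n : nat) (y : 'I_n -> F) (lam2 : 'cV[int]_n) : F :=
  alternant y (lam2 + weyl_vector2 n) / alternant y (weyl_vector2 n).

(* Twice the weight ((5/2)^p, (3/2)^q, (1/2)^(n - p - q)). *)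
Definition weight531 (n p q : nat) : 'cV[int]_n :=
  \col_(i < n) (if (i < p)%N then 5 else if (i < p + q)%N then 3 else 1).

Definition eta (s : nat) : int :=
  match (s %% 5)%N with 0%N | 2%N => 1 | 3%N | 4%N => -1 | _ => 0 end.
Definition zeta (r : nat) : int :=
  match (r %% 5)%N with 1%N => 1 | 0%N => -1 | _ => 0 end.
Definition omega (r : nat) : int :=
  match (r %% 5)%N with 2%N => 1 | 3%N => -1 | _ => 0 end.
Definition sigma (s : nat) : int :=
  match (s %% 5)%N with 3%N => 1 | 1%N => -1 | _ => 0 end.
Definition tau (s : nat) : int :=
  match (s %% 5)%N with 3%N => 1 | 0%N => -1 | _ => 0 end.
Definition rho (s : nat) : int :=
  match (s %% 5)%N with 2%N | 3%N => 1 | 0%N => -2%:Z | _ => 0 end.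

Definition nat_part (z : int) : nat := if z is Posz m then m else 0%N.

(* history f m = [:: u_(m-1); ...; u_1; u_0], where u_m = f (history f m).
   In f h with h = history f m, the entry h`_k is thus u_(m-1-k), and it is 0
   when m-1-k < 0. *)
Fixpoint history (A : Type) (f : seq A -> A) (m : nat) : seq A :=
  if m is k.+1 then let h := history f k in f h :: h else [::].

Section Coefficients.
Variables (K : fieldType) (a1 a5 : K).

Definition Qstep (h : seq K) : K :=
  if h is [::] then 1
  else - (a1 * a5) * h`_1 + a1 * a5 ^+ 2 * h`_2 + a5 ^+ 5 * h`_4.

Definition Rstep (h : seq K) : K :=
  if h is [::] then 1
  else a1 * h`_0 - a1 * a5 ^+ 3 * h`_3 + a5 ^+ 5 * h`_4
       + \sum_(3 <= s < (size h).+1)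
           (rho s)%:~R * a1 ^+ 2 * a5 ^+ (s - 2) * h`_(s - 1).

(* The defining recurrences are QcoefE and RcoefE below. *)
Definition Qcoef (q : int) : K :=
  if q is Posz m then Qstep (history Qstep m) else 0.
Definition Rcoef (r : int) : K :=
  if r is Posz m then Rstep (history Rstep m) else 0.

Definition chi (q r : int) : K :=
  Qcoef q * Rcoef r
  + \sum_(1 <= s < (nat_part r).+1)
      ((sigma s)%:~R * a1 * a5 ^+ s * Qcoef (q - 1) * Rcoef (r - s%:Z)
       + (tau s)%:~R * a1 * a5 ^+ s.+1 * Qcoef (q - 2) * Rcoef (r - s%:Z))
  - a5 ^+ 4 * Qcoef (q - 3) * Rcoef (r - 1).

Definition psi (q r : nat) : K :=
  chi q%:Z r%:Z - a5 ^+ 2 * chi q%:Z (r%:Z - 2)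
  + \sum_(2 <= s < r.+1)
      (eta s)%:~R * a1 * a5 ^+ (s - 1) * chi q%:Z (r%:Z - s%:Z)
  + (zeta r)%:~R * a5 ^+ r.+1 * chi (q%:Z - 1) 0
  + (omega r)%:~R * a5 ^+ r.+2 * chi (q%:Z - 2) 0.

Lemma size_history (A : Type) (f : seq A -> A) (m : nat) : size (history f m) = m.
Proof. by elim: m => //= m ->. Qed.

Lemma nth_history (f : seq K -> K) (m k : nat) :
  (history f m)`_k = if (k < m)%N then f (history f (m - k.+1)) else 0.
Proof.
by elim: m k => [|m IHm] [|k] //=; rewrite subn1.
Qed.

Lemma subz_cases (m k : nat) :
  m%:Z - k%:Z = if (k <= m)%N then (m - k)%N%:Z else Negz (k - m.+1).
Proof.
case: leqP => km; first by rewrite subzn.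
by rewrite NegzE -(subSn km) subSS -(subzn (ltnW km)) opprB.
Qed.

Lemma history_Q (m k : nat) : (history Qstep m)`_k = Qcoef (m%:Z - k.+1%:Z).
Proof. by rewrite nth_history subz_cases; case: ifP. Qed.

Lemma history_R (m k : nat) : (history Rstep m)`_k = Rcoef (m%:Z - k.+1%:Z).
Proof. by rewrite nth_history subz_cases; case: ifP. Qed.

Lemma Qcoef_neg (q : int) : q < 0 -> Qcoef q = 0.
Proof. by case: q. Qed.

Lemma Rcoef_neg (r : int) : r < 0 -> Rcoef r = 0.
Proof. by case: r. Qed.

Lemma Qcoef0 : Qcoef 0 = 1.
Proof. by []. Qed.

Lemma Rcoef0 : Rcoef 0 = 1.
Proof. by []. Qed.

Lemma QcoefE (q : int) : 0 < q ->
  Qcoef q = - (a1 * a5) * Qcoef (q - 2) + a1 * a5 ^+ 2 * Qcoef (q - 3)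
            + a5 ^+ 5 * Qcoef (q - 5).
Proof.
case: q => // -[|m] // _.
by rewrite -(history_Q m.+1 1) -(history_Q m.+1 2) -(history_Q m.+1 4).
Qed.

Lemma RcoefE (r : nat) : (0 < r)%N ->
  Rcoef r%:Z = a1 * Rcoef (r%:Z - 1) - a1 * a5 ^+ 3 * Rcoef (r%:Z - 4)
    + a5 ^+ 5 * Rcoef (r%:Z - 5)
    + \sum_(3 <= s < r.+1)
        (rho s)%:~R * a1 ^+ 2 * a5 ^+ (s - 2) * Rcoef (r%:Z - s%:Z).
Proof.
case: r => // m _.
rewrite -(history_R m.+1 0) -(history_R m.+1 3) -(history_R m.+1 4).
set h := history Rstep m.+1.
transitivity (a1 * h`_0 - a1 * a5 ^+ 3 * h`_3 + a5 ^+ 5 * h`_4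
  + \sum_(3 <= s < (size h).+1)
      (rho s)%:~R * a1 ^+ 2 * a5 ^+ (s - 2) * h`_(s - 1)) => //.
congr (_ + _); rewrite size_history.
rewrite big_nat [RHS]big_nat; apply: eq_bigr => s /andP[s3 _].
by rewrite history_R subn1 prednK // (leq_trans _ s3).
Qed.

End Coefficients.

(* Laurent polynomials in x_1^(1/2), ..., x_n^(1/2) over K live in the field of
   rational functions K(y_1, ..., y_n), with y_i = x_i^(1/2). *)
Definition ratfun (K : fieldType) (n : nat) : fieldType := {fraction {mpoly K[n]}}.

Definition cst (K : fieldType) (n : nat) (c : K) : ratfun K n := tofrac (c%:MP_[n]).

Definition sqrtx (K : fieldType) (n : nat) (i : 'I_n) : ratfun K n :=
  tofrac ('X_i : {mpoly K[n]}).

(* Main.v *)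
Require Import Defs.
From HB Require Import structures.
From mathcomp Require Import all_boot all_order all_fingroup all_algebra.
From mathcomp Require Import mpoly.
From mathcomp Require Import ring zify.
Set Implicit Arguments.
Unset Strict Implicit.
Unset Printing Implicit Defensive.
Import GRing.Theory.
Local Open Scope ring_scope.

(** Write [a = a1], [b = a5], [y = x^(1/2)] and [t_k = y^(2k) - y^(-2k)], so
    that [t_0 = 0] and [t_(-k) = - t_k].  Signed permutations turn Weyl's
    numerators and denominator into determinants with entries [y^m - y^(-m)]
    ([alternant_det]).  The product times the denominator is therefore the
    determinant whose rows, for [J = n, ..., 1], are
    [f(y) (y^(2J-1) - y^(-(2J-1)))], where [f] is the factor of the product,
    and such a row equals [b t_(J+2) + a (t_J + t_(J-1)) + b t_(J-3)]
    ([factor_rowE]).  Only the rows [t_1, ..., t_(n+2)] occur, and the character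
    of weight [((5/2)^p, (3/2)^q, (1/2)^r)] has as numerator the minor of these
    rows that omits [t_(r+1)] and [t_(r+q+2)].  So the coefficients wanted are
    the maximal minors of an [n] by [n+2] band matrix.

    For [b != 0] these minors are read off from the kernel of the band matrix.
    The kernel consists of the solutions of
    [b u_(j+2) + a (u_j + u_(j-1)) + b u_(j-3) = 0] with [u_(-j) = - u_j], a
    plane on which [u_1] and [u_2] are free.  Put a basis of it as two extra
    columns next to the rows [t_k]: a triangular elimination of determinant
    [b^n] leaves the determinant above ([elim_two_cols]), while Laplace
    expansion along the two columns ([det_two_cols]) produces the minors,
    weighted by the 2 by 2 determinants [W] of the two solutions.

    What remains is the scalar identity
    [psi(q, r) = (-b)^q b^r W(r+1, r+q+2)] ([psi_wronsk]).  For fixed [r], both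
    sides satisfy in [q] the recurrence that defines [Q], which reduces the
    claim to the sequences [W(j, j+1)] and [W(j, j+2)].  These two are
    linked by a pair of short recurrences ([gap1E], [gap2E]); eliminating the
    second sequence gives a renewal equation with the same kernel as the
    recurrence that defines [R] ([gap1_renewal]), so that [W(j, j+1)] is a
    convolution with [R] ([gap1_conv]).  The sums over residues modulo 5 in [psi], [chi] and [R] all
    come from dividing by [1 - (b z)^5] in this elimination.

    For [b = 0] the band matrix is bidiagonal, and one character is left
    ([det_factor_row_bidiag], [psi_bidiag]). *)

Local Notation "n .+5" := (n.+4.+1)%N (at level 1, left associativity, format "n .+5") : nat_scope.

(** * The coefficients as determinants of solutions of a linear recurrence *)

Fixpoint lin5 (K : fieldType) (c x0 x1 x2 x3 x4 : K) (n : nat) : K :=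
  if n is k.+1 then lin5 c x1 x2 x3 x4 (- x0 - c * (x3 + x2)) k else x0.

Lemma lin5E (K : fieldType) (c x0 x1 x2 x3 x4 : K) (n : nat) :
  let u := lin5 c x0 x1 x2 x3 x4 in
  u n.+5 = - u n - c * (u n.+3 + u n.+2).
Proof. by elim: n x0 x1 x2 x3 x4 => [|n IHn] x0 x1 x2 x3 x4 //; apply: IHn. Qed.

(** In terms of generating functions: [u = 1 / (1 - k)] and [e = N / (1 - k)]
    give [e = N u]. *)
Lemma renewal (K : fieldType) (k u N e : nat -> K) :
  (forall n, u n = (n == 0%N)%:R + \sum_(1 <= t < n.+1) k t * u (n - t)%N) ->
  (forall n, e n = N n + \sum_(1 <= t < n.+1) k t * e (n - t)%N) ->
  forall n, e n = \sum_(0 <= s < n.+1) N s * u (n - s)%N.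
Proof.
move=> uE eE; elim/ltn_ind => n IHn.
rewrite eE [RHS]big_nat_recr //= subnn.
have -> : u 0%N = 1 by rewrite uE big_geq // addr0.
rewrite mulr1 addrC; congr (_ + _).
transitivity (\sum_(1 <= t < n.+1) \sum_(0 <= s < n | (t + s <= n)%N)
    N s * (k t * u (n - s - t)%N)).
  rewrite [LHS]big_nat [RHS]big_nat; apply: eq_bigr => t /andP[t0 tn].
  rewrite IHn ?ltn_subrL ?t0 ?(leq_trans t0) //.
  rewrite (big_nat_widen 0 (n - t).+1 n); last by lia.
  rewrite big_distrr /= [LHS]big_nat_cond [RHS]big_nat_cond.
  apply: eq_big => [s|s _]; first by apply/idP/idP; lia.
  by rewrite mulrCA subnAC.
rewrite (exchange_big_dep xpredT) //=.
rewrite [LHS]big_nat [RHS]big_nat; apply: eq_bigr => s /andP[_ sn].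
rewrite [u (n - s)%N]uE subn_eq0 leqNgt sn add0r big_distrr /=.
rewrite [RHS](big_nat_widen 1 _ n.+1); last by lia.
by rewrite [LHS]big_nat_cond [RHS]big_nat_cond; apply: eq_bigl => t; lia.
Qed.

Section Solutions.
Variables (K : fieldType) (a b : K).

(** The two antisymmetric solutions, stored with a shift of 2: [sol1 i] is [u_(i-2)]
    with [u_1 = 1], [u_2 = 0], and [sol2 i] has [u_1 = 0], [u_2 = 1].  Five
    consecutive values centred at [u_0 = 0] are the initial data. *)
Definition sol1 : nat -> K := lin5 (a / b) 0 (-1) 0 1 0.
Definition sol2 : nat -> K := lin5 (a / b) (-1) 0 0 0 1.

Definition wronsk (i j : nat) : K := sol1 i * sol2 j - sol1 j * sol2 i.

Lemma wronskC i j : wronsk i j = - wronsk j i.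
Proof. by rewrite /wronsk opprB. Qed.

Lemma wronsk_diag i : wronsk i i = 0.
Proof. exact: subrr. Qed.

Lemma wronskE i j :
  wronsk i j.+5 = - wronsk i j - a / b * (wronsk i j.+3 + wronsk i j.+2).
Proof. by rewrite /wronsk /sol1 /sol2 !lin5E; ring. Qed.

(** Apply the recurrence in the larger argument, exchange the arguments, and
    apply it again: neighbours five steps apart are compared. *)
Lemma wronsk_skip1E i :
  wronsk i.+5 i.+1.+5 = wronsk i i.+1
    - a / b * (wronsk i.+1 i.+3 + wronsk i.+1 i.+2)
    + a / b * (wronsk i.+4 i.+5 + wronsk i.+3 i.+5).
Proof.
rewrite wronskE [wronsk _ i.+4]wronskC [wronsk _ i.+3]wronskC.
by rewrite [wronsk i.+5 i.+1]wronskC wronskE [wronsk i.+1 i]wronskC; ring.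
Qed.

Lemma wronsk_skip2E i :
  wronsk i.+5 i.+2.+5 = wronsk i i.+2
    + a / b * (wronsk i.+4 i.+5 - wronsk i.+2 i.+3).
Proof.
rewrite wronskE wronsk_diag [wronsk _ i.+4]wronskC [wronsk _ i.+2]wronskC.
by rewrite [wronsk i.+2 _]wronskE wronsk_diag [wronsk i.+2 i]wronskC; ring.
Qed.

(** [gap1 r] and [gap2 r] will be [psi 0 r] and [psi 1 r]; they are extended by
    [0] to negative arguments, like [Rcoef]. *)
Definition gap1 (z : int) : K :=
  if z is Posz r then b ^+ r * wronsk r.+3 r.+4 else 0.
Definition gap2 (z : int) : K :=
  if z is Posz r then - b ^+ r.+1 * wronsk r.+3 r.+5 else 0.

Hypothesis b0 : b != 0.

(** The list holds the boundary terms, which come from the negatively indexed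
    values of the solutions that [gap1] and [gap2] cut off. *)
Lemma gap2E (r : nat) :
  gap2 r%:Z = [:: - b; b ^+ 2]`_r - a * b * gap1 (r%:Z - 1)
    + a * b ^+ 3 * gap1 (r%:Z - 3) + b ^+ 5 * gap2 (r%:Z - 5).
Proof.
case: r => [|[|[|[|[|r]]]]]; rewrite !subz_cases /=.
1-5: by rewrite /wronsk /sol1 /sol2 /=; field.
rewrite ?add1n !subSS !subn0 /=.
by rewrite wronsk_skip2E !exprS; field.
Qed.

Lemma gap1E (r : nat) :
  gap1 r%:Z = [:: 1; 0; - b ^+ 2]`_r + a * gap1 (r%:Z - 1)
    - a * b ^+ 3 * gap1 (r%:Z - 4) + b ^+ 5 * gap1 (r%:Z - 5)
    - a * gap2 (r%:Z - 2) + a * b ^+ 2 * gap2 (r%:Z - 4).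
Proof.
case: r => [|[|[|[|[|r]]]]]; rewrite !subz_cases /=.
1-5: by rewrite /wronsk /sol1 /sol2 /=; field.
rewrite ?add1n !subSS !subn0 /=.
by rewrite wronsk_skip1E !exprS; field.
Qed.

(** Division of the recurrence [gap2E] by [1 - (b z)^5]; the residues 1 and 3 of
    [sigma] are the shifts of [gap1] in it, and [zeta] is made of its boundary
    terms. *)
Lemma gap2_sum (r : nat) :
  gap2 r%:Z = (zeta r)%:~R * b ^+ r.+1
    + \sum_(1 <= s < r.+1) (sigma s)%:~R * a * b ^+ s * gap1 (r%:Z - s%:Z).
Proof.
elim/ltn_ind: r => r IHr; rewrite gap2E.
case: r IHr => [|[|[|[|[|r]]]]] IHr.
1-5: by rewrite /index_iota /= ?big_cons big_nil /zeta /sigma ?subz_cases /=; ring.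
rewrite (@big_cat_nat _ _ _ 6) // [index_iota 1 6]/= !big_cons big_nil -[6%N]/(1 + 5)%N big_addn.
rewrite (_ : r.+5.+1 - 5 = r.+1)%N; last by lia.
rewrite (_ : r.+5%:Z - 5 = r); last by lia.
rewrite IHr; last by lia.
rewrite (_ : zeta r.+5 = zeta r); last by rewrite /zeta -[r.+5]/(5 + r)%N modnDl.
under [in RHS]eq_big_nat => s _.
  rewrite (_ : sigma (s + 5) = sigma s); last by rewrite /sigma modnDr.
  rewrite (_ : r.+5%:Z - (s + 5)%N%:Z = r%:Z - s%:Z); last by lia.
  rewrite exprD (mulrA _ (b ^+ s)) (mulrC _ (b ^+ 5)) -!(mulrA (b ^+ 5)).
  over.
by rewrite -big_distrr /= /sigma !exprS /=; ring.
Qed.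

(** The truncated difference [s - d] is [0] for [s <= d], where [sigma 0 = 0]
    removes the term; so all delays share one range of summation. *)
Lemma gap2_delay (d r : nat) :
  b ^+ d * gap2 (r%:Z - d%:Z) = (if (d <= r)%N then (zeta (r - d))%:~R else 0) * b ^+ r.+1
    + \sum_(1 <= s < r.+1)
        (sigma (s - d))%:~R * a * b ^+ s * gap1 (r%:Z - s%:Z).
Proof.
case: leqP => dr.
  rewrite subzn // gap2_sum [in RHS](@big_cat_nat _ _ _ d.+1) //=.
  rewrite [X in _ = _ + (X + _)]big_nat [X in _ = _ + (X + _)]big1 => [|s /andP[_ sd]]; last first.
    by rewrite (eqP (_ : s - d == 0)%N) ?subn_eq0 // /sigma /= !mul0r.
  rewrite add0r -[d.+1]add1n big_addn mulrDr big_distrr /=.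
  rewrite mulrCA -exprD addnS subnKC // -(subSn dr); congr (_ + _).
  rewrite [LHS]big_nat [RHS]big_nat; apply: eq_bigr => s _.
  rewrite addnK exprD (_ : (r - d)%N%:Z - s%:Z = r%:Z - (s + d)%N%:Z); last by lia.
  by ring.
rewrite subz_cases leqNgt dr /= mulr0 mul0r add0r.
rewrite big_nat big1 // => s /andP[_ sr].
by rewrite (eqP (_ : s - d == 0)%N) /sigma ?subn_eq0 /= ?mul0r //; lia.
Qed.

Definition vanish_neg (U : int -> K) := forall z, z < 0 -> U z = 0.

Lemma sum_pick (U : int -> K) (x : K) (m d n : nat) : vanish_neg U -> (m <= d)%N ->
  \sum_(m <= t < n.+1) (if t == d then x else 0) * U (n%:Z - t%:Z)
  = x * U (n%:Z - d%:Z).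
Proof.
move=> U0 md; case: (leqP d n) => dn.
  rewrite (bigD1_seq d) ?mem_index_iota ?iota_uniq ?md //= eqxx.
  by rewrite big1 ?addr0 // => t /negPf->; rewrite mul0r.
rewrite U0 ?mulr0; last by lia.
by rewrite big_nat big1 // => t tn; case: eqP tn => [->|]; rewrite ?mul0r //; lia.
Qed.

Lemma sum_from (m k n : nat) (E : nat -> K) : (m <= k)%N ->
  \sum_(m <= t < n) (if (k <= t)%N then E t else 0) = \sum_(k <= t < n) E t.
Proof. by move=> mk; rewrite (big_nat_widenl k m) // big_mkcond. Qed.

(** The kernel [k] for which [RcoefE] reads [R = 1 + k R]. *)
Definition Rkernel (t : nat) : K :=
  (if t == 1%N then a else 0) - (if t == 4%N then a * b ^+ 3 else 0)
  + (if t == 5%N then b ^+ 5 else 0)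
  + (if (3 <= t)%N then (rho t)%:~R * a ^+ 2 * b ^+ (t - 2) else 0).

Lemma sum_Rkernel (U : int -> K) (n : nat) : vanish_neg U ->
  \sum_(1 <= t < n.+1) Rkernel t * U (n%:Z - t%:Z)
  = a * U (n%:Z - 1) - a * b ^+ 3 * U (n%:Z - 4) + b ^+ 5 * U (n%:Z - 5)
    + \sum_(3 <= s < n.+1) (rho s)%:~R * a ^+ 2 * b ^+ (s - 2) * U (n%:Z - s%:Z).
Proof.
move=> U0; rewrite -(sum_pick a n U0 (leqnn 1)) -(sum_pick (a * b ^+ 3) n U0 (isT : 1 <= 4)%N).
rewrite -(sum_pick (b ^+ 5) n U0 (isT : 1 <= 5)%N) -(sum_from _ _ (isT : 1 <= 3)%N).
rewrite -sumrN -!big_split /=; apply: eq_bigr => t _.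
by rewrite /Rkernel !mulrDl mulNr; case: (3 <= t)%N; rewrite ?mul0r.
Qed.

(** The weights by which [psi] combines the values [chi q r], ..., [chi q 0]. *)
Definition numer (s : nat) : K :=
  (if s == 0%N then 1 else 0) - (if s == 2%N then b ^+ 2 else 0)
  + (if (2 <= s)%N then (Defs.eta s)%:~R * a * b ^+ (s - 1) else 0).

Lemma sum_numer (U : int -> K) (n : nat) : vanish_neg U ->
  \sum_(0 <= t < n.+1) numer t * U (n%:Z - t%:Z)
  = U n%:Z - b ^+ 2 * U (n%:Z - 2)
    + \sum_(2 <= s < n.+1) (Defs.eta s)%:~R * a * b ^+ (s - 1) * U (n%:Z - s%:Z).
Proof.
move=> U0; rewrite -[U n%:Z]mul1r -{2}[n%:Z]subr0 -(sum_pick 1 n U0 (leqnn 0)).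
rewrite -(sum_pick (b ^+ 2) n U0 (isT : 0 <= 2)%N) -(sum_from _ _ (isT : 0 <= 2)%N).
rewrite -sumrN -!big_split /=; apply: eq_bigr => t _.
by rewrite /numer !mulrDl mulNr; case: (2 <= t)%N; rewrite ?mul0r.
Qed.

Lemma gap1_neg : vanish_neg gap1. Proof. by case. Qed.

Lemma Rcoef_renewal (n : nat) :
  Rcoef a b n%:Z = (n == 0%N)%:R
    + \sum_(1 <= t < n.+1) Rkernel t * Rcoef a b (n%:Z - t%:Z).
Proof.
rewrite sum_Rkernel; last exact: Rcoef_neg.
case: n => [|n]; last by rewrite RcoefE ?add0r.
by rewrite big_geq //= !mulr0 subrr !addr0.
Qed.

Lemma rho_sigma (s : nat) : (0 < s)%N -> rho s.+2 = sigma (s - 2) - sigma s.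
Proof.
case: s => [|[|s]] // _; rewrite subn2 /=.
rewrite /rho /sigma -[s.+4]addn4 -[s.+2]addn2 -(modnDml s 4) -(modnDml s 2).
by have := ltn_pmod s (isT : 0 < 5)%N; case: (s %% 5)%N => [|[|[|[|[|]]]]].
Qed.

Lemma eta_zeta (s : nat) :
  Defs.eta s.+2 = (if (2 <= s)%N then zeta (s - 2) else 0) - zeta s.
Proof.
case: s => [|[|s]] //; rewrite subn2 /=.
rewrite /Defs.eta /zeta -[s.+4]addn4 -[s.+2]addn2 -(modnDml s 4) -(modnDml s 2).
by have := ltn_pmod s (isT : 0 < 5)%N; case: (s %% 5)%N => [|[|[|[|[|]]]]].
Qed.

Lemma tau_sigma (s : nat) : (0 < s)%N -> tau s = - sigma (s - 2).
Proof.
case: s => [|[|s]] // _; rewrite subn2 /= /tau /sigma -addn2 -modnDml.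
by have := ltn_pmod s (isT : 0 < 5)%N; case: (s %% 5)%N => [|[|[|[|[|]]]]].
Qed.

Lemma omega_zeta (r : nat) : omega r = - (if (2 <= r)%N then zeta (r - 2) else 0).
Proof.
case: r => [|[|r]] //; rewrite subn2 /= /omega /zeta -addn2 -modnDml.
by have := ltn_pmod r (isT : 0 < 5)%N; case: (r %% 5)%N => [|[|[|[|[|]]]]].
Qed.

(** Substituting [gap2_sum] into [gap1E] eliminates [gap2]: the two delayed copies
    of [sigma] combine to [rho], and those of [zeta] to [eta]. *)
Lemma gap1_renewal (n : nat) :
  gap1 n%:Z = numer n + \sum_(1 <= t < n.+1) Rkernel t * gap1 (n%:Z - t%:Z).
Proof.
rewrite sum_Rkernel; last exact: gap1_neg.
case: n => [|[|m]].
1-2: by rewrite gap1E big_geq // /numer !subz_cases /=; ring.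
(* By [rho_sigma], after a shift by 2 the sum is a difference of two delayed sums. *)
have -> : \sum_(3 <= s < m.+3) (rho s)%:~R * a ^+ 2 * b ^+ (s - 2) * gap1 (m.+2%:Z - s%:Z)
    = a * (\sum_(1 <= s < m.+1) (sigma (s - 2))%:~R * a * b ^+ s * gap1 (m%:Z - s%:Z))
    - a * (\sum_(1 <= s < m.+1) (sigma (s - 0))%:~R * a * b ^+ s * gap1 (m%:Z - s%:Z)).
  rewrite -[3%N]/(1 + 2)%N big_addn subn2 /= !big_distrr /= -sumrB.
  rewrite [LHS]big_nat [RHS]big_nat; apply: eq_bigr => s /andP[s0 _].
  rewrite addnK subn0 addn2 rho_sigma //.
  rewrite (_ : m.+2%:Z - s.+2%:Z = m%:Z - s%:Z); last by lia.
  by rewrite rmorphB; ring.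
have := gap2_delay 2 m; have := gap2_delay 0 m.
rewrite expr0 mul1r subr0 leq0n !subn0 => E0 E2.
rewrite gap1E (_ : m.+2%:Z - 2 = m); last by lia.
rewrite (_ : m.+2%:Z - 4 = m%:Z - 2); last by lia.
have -> : ([:: 1; 0; - b ^+ 2]`_m.+2 : K) = - (if m == 0%N then b ^+ 2 else 0).
  by case: m {E0 E2} => [|m] //=; rewrite nth_nil oppr0.
rewrite -[a * b ^+ 2 * _]mulrA E0 E2 /numer !eqSS eta_zeta subn1 rmorphB /=.
by case: (2 <= m)%N; rewrite /=; ring.
Qed.

(** The bound [M] may exceed [z], since [Rcoef] vanishes at negative arguments;
    hence several shifts of [gap1] can be written over the same range. *)
Lemma gap1_conv (M : nat) (z : int) : z <= M ->
  gap1 z = \sum_(0 <= t < M.+1) numer t * Rcoef a b (z - t%:Z).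
Proof.
case: z => [n|n] nM; last first.
  by rewrite big1 // => t _; rewrite Rcoef_neg ?mulr0 //; lia.
have -> : gap1 n = \sum_(0 <= s < n.+1) numer s * Rcoef a b (n - s)%N%:Z.
  apply: (@renewal _ Rkernel (fun m => Rcoef a b m%:Z) numer (fun m => gap1 m%:Z)) => m.
    rewrite {1}Rcoef_renewal; congr (_ + _); apply: eq_big_nat => t /andP[_ tm].
    by rewrite subzn.
  rewrite {1}gap1_renewal; congr (_ + _); apply: eq_big_nat => t /andP[_ tm].
  by rewrite subzn.
rewrite [RHS](@big_cat_nat _ _ _ n.+1) //=.
rewrite [X in _ = _ + X]big_nat [X in _ = _ + X]big1 ?addr0 => [|t /andP[nt _]].
  by apply: eq_big_nat => t /andP[_ tn]; rewrite subzn.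
by rewrite Rcoef_neg ?mulr0 //; lia.
Qed.

Local Notation Q := (Qcoef a b).
Local Notation R := (Rcoef a b).

Lemma chi_sum (q : int) (M : nat) (z : int) : z <= M ->
  chi a b q z = Q q * R z
    + \sum_(1 <= s < M.+1)
        ((sigma s)%:~R * a * b ^+ s * Q (q - 1)
         + (tau s)%:~R * a * b ^+ s.+1 * Q (q - 2)) * R (z - s%:Z)
    - b ^+ 4 * Q (q - 3) * R (z - 1).
Proof.
case: z => [n|n] zM; rewrite /chi.
  congr (_ + _ - _); rewrite [RHS](@big_cat_nat _ _ _ n.+1) //=.
  rewrite [X in _ = _ + X]big_nat [X in _ = _ + X]big1 ?addr0.
    by apply: eq_bigr => s _; rewrite mulrDl.
  by move=> t /andP[nt _]; rewrite Rcoef_neg ?mulr0 //; lia.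
congr (_ + _ - _); rewrite /= big_geq // big1 // => s _.
by rewrite Rcoef_neg ?mulr0 //; lia.
Qed.

Lemma chi_neg (q z : int) : z < 0 -> chi a b q z = 0.
Proof.
move=> z0; rewrite (@chi_sum _ 0) ?big_geq //; last exact: Order.POrderTheory.ltW.
by rewrite !Rcoef_neg ?mulr0 ?addr0 ?subr0 //; lia.
Qed.

(** The convolution with [numer] turns every [Rcoef] in [chi] into [gap1]; the
    sums with [sigma] and [tau] then become values of [gap2], as [tau] and
    [omega] are [- sigma] and [- zeta] delayed by 2. *)
Lemma psi_gap (q r : nat) :
  psi a b q r = Q q%:Z * gap1 r%:Z + Q (q%:Z - 1) * gap2 r%:Z
    - b ^+ 3 * Q (q%:Z - 2) * gap2 (r%:Z - 2) - b ^+ 4 * Q (q%:Z - 3) * gap1 (r%:Z - 1).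
Proof.
rewrite /psi -(sum_numer _ (@chi_neg q%:Z)).
have chi0 z : chi a b z 0 = Q z.
  by rewrite /chi big_geq //= mulr1 mulr0 subr0 addr0.
rewrite !chi0.
have -> : \sum_(0 <= t < r.+1) numer t * chi a b q%:Z (r%:Z - t%:Z)
    = Q q%:Z * gap1 r%:Z
      + \sum_(1 <= s < r.+1)
        ((sigma s)%:~R * a * b ^+ s * Q (q%:Z - 1)
         + (tau s)%:~R * a * b ^+ s.+1 * Q (q%:Z - 2)) * gap1 (r%:Z - s%:Z)
      - b ^+ 4 * Q (q%:Z - 3) * gap1 (r%:Z - 1).
  rewrite (gap1_conv (Order.POrderTheory.lexx r%:Z)) (@gap1_conv r (r%:Z - 1)); last by lia.
  under [X in _ = _ + X - _]eq_bigr => s _.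
    rewrite (@gap1_conv r (r%:Z - s%:Z)); last by lia.
    rewrite big_distrr /=; over.
  rewrite exchange_big /= !big_distrr /= -big_split -sumrB /=.
  apply: eq_bigr => t _; rewrite (@chi_sum _ r); last by lia.
  rewrite mulrBr mulrDr big_distrr /= (addrAC _ (- 1)).
  congr (_ + _ - _); [by ring | | by ring].
  by apply: eq_bigr => s _; rewrite addrAC; ring.
have -> : \sum_(1 <= s < r.+1)
        ((sigma s)%:~R * a * b ^+ s * Q (q%:Z - 1)
         + (tau s)%:~R * a * b ^+ s.+1 * Q (q%:Z - 2)) * gap1 (r%:Z - s%:Z)
    = Q (q%:Z - 1) * (\sum_(1 <= s < r.+1)
        (sigma (s - 0))%:~R * a * b ^+ s * gap1 (r%:Z - s%:Z))
      - b * Q (q%:Z - 2) * (\sum_(1 <= s < r.+1)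
        (sigma (s - 2))%:~R * a * b ^+ s * gap1 (r%:Z - s%:Z)).
  rewrite !big_distrr /= -sumrB; apply: eq_big_nat => s /andP[s0 _].
  by rewrite tau_sigma // rmorphN subn0 exprS /=; ring.
have := gap2_delay 0 r; have := gap2_delay 2 r.
rewrite mul1r subr0 leq0n !subn0 omega_zeta rmorphN /= => E2 E0.
rewrite [_ * gap2 (_ - 2)](_ : _ = b * Q (q%:Z - 2) * (b ^+ 2 * gap2 (r%:Z - 2)));
  last by ring.
by rewrite E0 E2 (exprS b r.+1); case: (2 <= r)%N; rewrite /=; ring.
Qed.

(** Both sides satisfy the recurrence of [Q] in [q] as soon as [q >= 4], when every
    [Q] in [psi_gap] has a positive argument; the values [q < 4] are checked
    directly. *)
Lemma psi_wronsk (q r : nat) :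
  psi a b q r = (- b) ^+ q * b ^+ r * wronsk r.+3 (r + q).+4.
Proof.
rewrite psi_gap.
have gap1_prev : gap1 (r%:Z - 1) * b = b ^+ r * wronsk r.+2 r.+3.
  case: r => [|r]; rewrite subz_cases /=; first by rewrite /wronsk /sol1 /sol2 /=; ring.
  by rewrite subn1 exprS /=; ring.
have gap2_prev : gap2 (r%:Z - 2) * b = - b ^+ r * wronsk r.+1 r.+3.
  case: r {gap1_prev} => [|[|r]]; rewrite subz_cases /=.
  1-2: by rewrite /wronsk /sol1 /sol2 /=; ring.
  by rewrite subn2 !exprS /=; ring.
pose E z := Q z * gap1 r%:Z + Q (z - 1) * gap2 r%:Z
    - b ^+ 3 * Q (z - 2) * gap2 (r%:Z - 2) - b ^+ 4 * Q (z - 3) * gap1 (r%:Z - 1).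
rewrite -/(E q%:Z).
have EE z : 3 < z -> E z = - (a * b) * E (z - 2) + a * b ^+ 2 * E (z - 3) + b ^+ 5 * E (z - 5).
  move=> z3; have QE i : i < 4 -> Q (z - i) = - (a * b) * Q (z - i - 2)
      + a * b ^+ 2 * Q (z - i - 3) + b ^+ 5 * Q (z - i - 5).
    by move=> i4; apply: QcoefE; lia.
  rewrite {1}/E (QE 3) // (QE 2) // (QE 1) // -{1}[z]subr0 (QE 0) // subr0 /E.
  have swap i j : z - i - j = z - j - i by rewrite addrAC.
  by rewrite (swap 2 1) (swap 3 1) (swap 3 2) (swap 5 1) (swap 5 2) (swap 5 3); ring.
have [Q0 Q1 Q2 Q3] : [/\ Q 0 = 1, Q 1 = 0, Q 2 = - (a * b) & Q 3 = a * b ^+ 2].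
  by split; rewrite //=; ring.
have [E0 E1] : E 0 = gap1 r%:Z /\ E 1 = gap2 r%:Z.
  by rewrite /E subrr Q0 Q1 !Qcoef_neg //; split; ring.
have E2 : E 2 = - (a * b) * gap1 r%:Z - b ^+ 3 * gap2 (r%:Z - 2).
  by rewrite /E subrr -[2 - 1]/(1 : int) Q0 Q1 Q2 !Qcoef_neg //; ring.
have E3 : E 3 = a * b ^+ 2 * gap1 r%:Z - a * b * gap2 r%:Z - b ^+ 4 * gap1 (r%:Z - 1).
  by rewrite /E subrr -[3 - 1]/(2 : int) -[3 - 2]/(1 : int) Q0 Q1 Q2 Q3; ring.
elim/ltn_ind: q => q IHq; case: q IHq => [|[|[|[|[|q]]]]] IHq.
- by rewrite E0 addn0 mul1r.
- by rewrite E1 addn1 /= exprS; ring.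
- rewrite E2 (_ : b ^+ 3 * gap2 (r%:Z - 2) = b ^+ 2 * (gap2 (r%:Z - 2) * b)); last by ring.
  rewrite gap2_prev addn2 wronskE wronsk_diag [wronsk r.+3 r.+1]wronskC /=.
  by field.
- rewrite E3 (_ : b ^+ 4 * gap1 (r%:Z - 1) = b ^+ 3 * (gap1 (r%:Z - 1) * b)); last by ring.
  rewrite gap1_prev addn3 wronskE [wronsk r.+3 r.+2]wronskC /= (exprS b r).
  by field.
- have Eneg : E (4%:Z - 5) = 0 by rewrite /E !Qcoef_neg //; ring.
  rewrite EE // Eneg -[4%:Z - 2]/(2%:Z) -[4%:Z - 3]/(1%:Z).
  rewrite !IHq // addn1 addn2 addn4 (wronskE r.+3 r.+3) wronsk_diag.
  by field.
rewrite EE // (_ : q.+5%:Z - 2 = q.+3%:Z); last by lia.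
rewrite (_ : q.+5%:Z - 3 = q.+2%:Z); last by lia.
rewrite (_ : q.+5%:Z - 5 = q%:Z); last by lia.
rewrite (IHq q.+3) ?(IHq q.+2) ?(IHq q) ?ltnS ?leqW // !addnS.
by rewrite (wronskE _ (r + q).+4) !exprS; field.
Qed.

End Solutions.

Lemma psi_bidiag (K : fieldType) (a : K) (q r : nat) :
  psi a 0 q r = if q == 0%N then a ^+ r else 0.
Proof.
have QE z : Qcoef a 0 z = (z == 0)%:R.
  case: z => [[|m]|m] //; rewrite QcoefE // [RHS]/=; ring.
have RE m : Rcoef a 0 m%:Z = a ^+ m.
  elim: m => [|m IHm] //; rewrite RcoefE //.
  rewrite big_nat big1 => [|s /andP[s3 _]]; last by rewrite expr0n subn_eq0 leqNgt s3 mulr0 mul0r.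
  rewrite (_ : m.+1%:Z - 1 = m); last by lia.
  by rewrite IHm (exprS a); ring.
have chiE (p : int) z : chi a 0 p z = Qcoef a 0 p * Rcoef a 0 z.
  rewrite /chi big_nat big1 => [|s /andP[s1 _]]; first by ring.
  by rewrite !expr0n gtn_eqF //=; ring.
rewrite /psi !chiE big_nat big1 => [|s /andP[s2 _]].
  by rewrite !expr0n RE QE eqz_nat; case: eqP => _ /=; ring.
by rewrite expr0n subn_eq0 leqNgt s2 mulr0 mul0r.
Qed.

(** * Determinants *)

Section Alternants.
Variable F : fieldType.

Definition alt_pow (z : F) (m : int) : F := z ^ m - z ^ (- m).

Lemma alt_powN z m : alt_pow z (- m) = - alt_pow z m.
Proof. by rewrite /alt_pow opprK opprB. Qed.

Lemma alt_pow_mul z m (d : nat) : z != 0 ->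
  (z ^+ d + z ^- d) * alt_pow z m = alt_pow z (m + d%:Z) + alt_pow z (m - d%:Z).
Proof.
move=> z0; rewrite /alt_pow !opprD !opprK !expfzDr // exprnP exprnN.
by ring.
Qed.

Lemma det_hyperoct n (w : hyperoct n) :
  \det (hyperoct_mx w) = (\prod_i (-1) ^+ w.2 i) * (-1) ^+ w.1 :> int.
Proof.
have -> : hyperoct_mx w = diag_mx (\row_i (-1) ^+ w.2 i) *m perm_mx w.1.
  by apply/matrixP => i j; rewrite mul_diag_mx !mxE.
by rewrite det_mulmx det_diag det_perm; congr (_ * _); apply: eq_bigr => i _; rewrite mxE.
Qed.

(** The sum over the signs of one coordinate gives one entry [y^m - y^(-m)], and
    the sum over permutations is the determinant. *)
Lemma alternant_det n (y : 'I_n -> F) (m : 'cV[int]_n) :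
  alternant y m = \det (\matrix_(i, j) alt_pow (y i) (m j 0)).
Proof.
rewrite /alternant [in RHS]/determinant.
under eq_bigr => w _ do rewrite det_hyperoct rmorphM rmorph_prod rmorph_sign /= mulrC mulrA mulrC.
rewrite -(pair_bigA _ (fun (s : {perm 'I_n}) (e : {ffun 'I_n -> bool}) =>
  (-1) ^+ s * (monomial y (hyperoct_mx (s, e) *m m)
    * \prod_i ((-1) ^+ e i)%:~R))) /=.
apply: eq_bigr => s _; rewrite -big_distrr /=; congr (_ * _).
transitivity (\prod_(i < n) \sum_(c : bool) (-1) ^+ c * y i ^ ((-1) ^+ c * m (s i) 0)).
  rewrite bigA_distr_bigA /=; apply: eq_bigr => e _.
  rewrite mulrC -big_split /=; apply: eq_bigr => i _.
  rewrite rmorph_sign !mxE (bigD1 (s i)) //= mxE eqxx mulr1 big1 ?addr0 // => j /negPf sj.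
  by rewrite mxE /= eq_sym sj mulr0 mul0r.
apply: eq_bigr => i _; rewrite mxE big_bool /= /alt_pow.
by rewrite expr0 expr1 !mul1r mulN1r mulN1r addrC.
Qed.

(** Row indices run over all naturals; [bump k \o bump l] skips [k] and, for
    [k <= l], also [l + 1]. *)
Definition minor2 n (T : nat -> 'I_n -> F) (k l : nat) : F :=
  \det (\matrix_(i < n, j < n) T (bump k (bump l i)) j).

Definition two_cols n (u w : nat -> F) (T : nat -> 'I_n -> F) : 'M[F]_n.+2 :=
  \matrix_(i, j) if unlift ord0 j is Some j'
    then if unlift ord0 j' is Some j'' then T i j'' else w i else u i.

Lemma det_two_cols_full n (u w : nat -> F) (T : nat -> 'I_n -> F) :
  \det (two_cols u w T) = \sum_(0 <= k < n.+2) \sum_(0 <= l < n.+1)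
    (-1) ^+ (k + l) * u k * w (bump k l) * minor2 T k l.
Proof.
rewrite (expand_det_col _ ord0) big_mkord; apply: eq_bigr => k _.
rewrite mxE unlift_none /cofactor (expand_det_col _ ord0) /= addn0 big_mkord !big_distrr /=.
apply: eq_bigr => l _; rewrite !mxE liftK unlift_none /cofactor /= addn0 exprD.
rewrite (_ : row' _ _ = \matrix_(i, j) T (bump k (bump l i)) j) -/(minor2 T k l); first by ring.
by apply/matrixP => i j; rewrite !mxE !liftK.
Qed.

Lemma minor2C n (T : nat -> 'I_n -> F) (k l : nat) : (k <= l)%N ->
  minor2 T l.+1 k = minor2 T k l.
Proof.
move=> kl; congr (\det _); apply/matrixP => i j; rewrite !mxE; congr (T _ j).
by rewrite /bump; lia.
Qed.

(** The terms in which the row used for [u] lies below the row used for [w] are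
    folded onto the others by [minor2C], with opposite sign. *)
Lemma det_two_cols n (u w : nat -> F) (T : nat -> 'I_n -> F) :
  \det (two_cols u w T) = \sum_(0 <= k < n.+1) \sum_(k <= l < n.+1)
    (-1) ^+ (k + l) * (u k * w l.+1 - u l.+1 * w k) * minor2 T k l.
Proof.
rewrite det_two_cols_full.
transitivity (\sum_(0 <= k < n.+1) \sum_(0 <= l < n.+1 | (k <= l)%N)
      (-1) ^+ (k + l) * u k * w (bump k l) * minor2 T k l
   + \sum_(0 <= k < n.+2) \sum_(0 <= l < n.+1 | (l < k)%N)
      (-1) ^+ (k + l) * u k * w (bump k l) * minor2 T k l).
  rewrite [X in _ = X + _](_ : _ = \sum_(0 <= k < n.+2) \sum_(0 <= l < n.+1 | (k <= l)%N)
      (-1) ^+ (k + l) * u k * w (bump k l) * minor2 T k l).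
    rewrite -big_split /=; apply: eq_bigr => k _.
    rewrite (bigID (fun l => (k <= l)%N)) /=; congr (_ + _).
    by apply: eq_bigl => l; rewrite ltnNge.
  rewrite [RHS]big_nat_recr //= [X in _ = _ + X]big_nat_cond [X in _ = _ + X]big1 ?addr0 // => l.
  by case/andP=> /andP[_ ln] /(leq_trans ln); rewrite ltnn.
rewrite [X in _ + X]big_nat_recl // [X in _ + (X + _)]big1 // add0r.
rewrite [X in _ + X](exchange_big_dep_nat xpredT) //= -big_split /=.
apply: eq_big_nat => k /andP[_ kn].
have widenl (G : nat -> F) : \sum_(k <= l < n.+1) G l = \sum_(0 <= l < n.+1 | (k <= l)%N) G l.
  by rewrite (big_nat_widenl k 0).
rewrite -widenl -[X in _ + X = _]widenl -big_split /=; apply: eq_big_nat => l /andP[kl _].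
have -> : bump k l = l.+1 by rewrite /bump kl.
have -> : bump l.+1 k = k by rewrite /bump leqNgt ltnS kl.
by rewrite minor2C // addSn (addnC l) exprS; ring.
Qed.

Section Expansion.
Variables (n : nat) (y : 'I_n -> F) (a b : F).
Hypothesis y0 : forall i, y i != 0.

(** Row [k] stands for the index [n + 2 - k], so that the band of row [k < n] sits
    at offsets 0, 2, 3 and 5.  Indices [-1] and [-2] are reflected to [1] and
    [2]: this is the last term, which lies in range only for the rows [n - 1] and
    [n - 2]. *)
Definition elim_mx : 'M[F]_n.+2 := \matrix_(k, l)
  if (k < n)%N then
    (if l == k :> nat then b else 0) + (if l == k.+2 :> nat then a else 0)
    + (if l == k.+3 :> nat then a else 0) + (if l == k.+5 :> nat then b else 0)
    - (if l == (n + (n - k.+1))%N :> nat then b else 0)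
  else if l == k :> nat then 1 else 0.

Lemma det_elim_mx : \det elim_mx = b ^+ n.
Proof.
rewrite -det_tr det_trig.
  rewrite !big_ord_recr /= !mxE /= ltnn !ltnNge leqnSn /= eqxx eqxx !mulr1.
  rewrite -[n in RHS]card_ord -prodr_const; apply: eq_bigr => i _.
  rewrite !mxE /= ltn_ord eqxx.
  by do !case: eqP; rewrite ?addr0 ?subr0 //; have := ltn_ord i; lia.
apply/is_trig_mxP => i j ij; rewrite !mxE.
by do !(case: eqP || case: ifP) ; rewrite ?addr0 ?subr0 //; lia.
Qed.

(** The action of the band on an antisymmetric sequence stored with a shift of 2. *)
Lemma elim_mxE (s : nat -> F) (k : 'I_n.+2) : s 0 = - s 4 -> s 1 = - s 3 -> s 2 = 0 ->
  \sum_l elim_mx k l * s (n.+4 - l)%N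
  = if (k < n)%N then
      b * s (n.+4 - k)%N + a * (s (n.+2 - k)%N + s (n.+1 - k)%N) + b * s (n - k.+1)%N
    else s (n.+4 - k)%N.
Proof.
move=> s0 s1 s2.
have pick d x : \sum_(l < n.+2) (if l == d :> nat then x else 0) * s (n.+4 - l)%N
    = if (d < n.+2)%N then x * s (n.+4 - d)%N else 0.
  rewrite -(big_ord1_eq +%R (fun l => x * s (n.+4 - l)%N)) [RHS]big_mkcond.
  by apply: eq_bigr => l _; case: eqP; rewrite ?mul0r.
case: ltnP => kn; last first.
  rewrite -[RHS]mul1r; have := pick k 1; rewrite ltn_ord => <-.
  by apply: eq_bigr => l _; rewrite mxE ltnNge kn.
under eq_bigr => l _ do rewrite mxE kn mulrBl !mulrDl.
rewrite sumrB !big_split /= !pick.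
have [j nE] : exists j, n = (k + j.+1)%N by exists (n - k.+1)%N; lia.
have -> : (n.+4 - k = j.+4.+1)%N by lia.
have -> : (n.+2 - k = j.+3)%N by lia.
have -> : (n.+1 - k = j.+2)%N by lia.
have -> : (n - k.+1 = j)%N by lia.
have -> : (n.+4 - k.+2 = j.+3)%N by lia.
have -> : (n.+4 - k.+3 = j.+2)%N by lia.
have -> : (n.+4 - k.+5 = j)%N by lia.
have -> : (n.+4 - (n + j) = 4 - j)%N by lia.
have -> : (k < n.+2)%N by lia.
have -> : (k.+2 < n.+2)%N by lia.
have -> : (k.+3 < n.+2)%N = (0 < j)%N by lia.
have -> : (k.+5 < n.+2)%N = (2 < j)%N by lia.
have -> : (n + j < n.+2)%N = (j < 2)%N by lia.
case: j {nE} => [|[|[|j]]] /=; rewrite ?s0 ?s1 ?s2; ring.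
Qed.

Definition even_row (k : nat) (i : 'I_n) : F := alt_pow (y i) (2 * (n.+2%:Z - k%:Z)).

Definition factor (z : F) : F := a * (z + z^-1) + b * (z ^+ 5 + z ^- 5).

Definition factor_row (k : nat) (i : 'I_n) : F :=
  factor (y i) * alt_pow (y i) (2 * (n%:Z - k%:Z) - 1).

Lemma factor_rowE (k : nat) (i : 'I_n) :
  factor_row k i = b * even_row k i + a * (even_row k.+2 i + even_row k.+3 i)
                   + b * even_row k.+5 i.
Proof.
rewrite /factor_row /factor /even_row; set M := 2 * (n%:Z - k%:Z) - 1.
have E1 := alt_pow_mul M 1 (y0 i); rewrite expr1 in E1.
have E5 := alt_pow_mul M 5 (y0 i).
have -> : 2 * (n.+2%:Z - k%:Z) = M + 5 by rewrite /M; lia.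
have -> : 2 * (n.+2%:Z - k.+2%:Z) = M + 1 by rewrite /M; lia.
have -> : 2 * (n.+2%:Z - k.+3%:Z) = M - 1 by rewrite /M; lia.
have -> : 2 * (n.+2%:Z - k.+5%:Z) = M - 5 by rewrite /M; lia.
by rewrite -E1 addrAC -mulrDr -E5; ring.
Qed.

Definition solution (u : nat -> F) :=
  [/\ u 0 = - u 4, u 1 = - u 3, u 2 = 0
    & forall m, b * u m.+5 + a * (u m.+3 + u m.+2) + b * u m = 0].

Lemma elim_solution (u : nat -> F) (k : 'I_n.+2) : solution u ->
  \sum_l elim_mx k l * u (n.+4 - l)%N = if (k < n)%N then 0 else u (n.+4 - k)%N.
Proof.
move=> [u0 u1 u2 uE]; rewrite elim_mxE //; case: ifP => // kn.
rewrite -[RHS](uE (n - k.+1)%N); congr (b * u _ + a * (u _ + u _) + _); lia.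
Qed.

(** The elimination annihilates the two solutions except in the last two rows,
    where they form a 2 by 2 exchange matrix: this is the source of the sign. *)
Lemma elim_two_cols (u w : nat -> F) :
  solution u -> solution w -> u 3 = 1 -> u 4 = 0 -> w 3 = 0 -> w 4 = 1 ->
  b ^+ n * \det (two_cols (fun k => u (n.+4 - k)%N) (fun k => w (n.+4 - k)%N) even_row)
  = - \det (\matrix_(k, i) factor_row k i).
Proof.
move=> [u0 u1 u2 uE] [w0 w1 w2 wE] u3 u4 w3 w4.
rewrite -det_elim_mx -det_mulmx.
have -> : elim_mx *m two_cols (fun k => u (n.+4 - k)%N) (fun k => w (n.+4 - k)%N) even_row
    = two_cols (fun k => (k == n.+1)%:R) (fun k => (k == n)%:R)
        (fun k i => if (k < n)%N then factor_row k i else even_row k i).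
  apply/matrixP => k j; rewrite [LHS]mxE [RHS]mxE.
  under eq_bigr => l _ do rewrite [two_cols _ _ _ _ _]mxE.
  have kn := ltn_ord k.
  case: (unliftP ord0 j) => [j1 _|_] /=; first case: (unliftP ord0 j1) => [i _|_] /=.
  - have even_s (l : 'I_n.+2) : even_row l i = alt_pow (y i) (2 * ((n.+4 - l)%N%:Z - 2)).
      by congr alt_pow; have := ltn_ord l; lia.
    under eq_bigr => l _ do rewrite even_s.
    rewrite (elim_mxE (s := fun m => alt_pow (y i) (2 * (m%:Z - 2)))) //; first last.
    + by rewrite subrr mulr0 /alt_pow subrr.
    + by rewrite -alt_powN; congr alt_pow; lia.
    + by rewrite -alt_powN; congr alt_pow; lia.
    case: ifP => nk; last by rewrite even_s.
    rewrite factor_rowE /even_row; congr (b * _ + a * (_ + _) + b * _); congr alt_pow; lia.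
  - rewrite elim_solution //; case: ltnP => [/ltn_eqF-> // | nk].
    have [->|kn1] := eqVneq (k : nat) n; first by rewrite (_ : n.+4 - n = 4)%N //; lia.
    by rewrite (_ : n.+4 - k = 3)%N //; lia.
  - rewrite elim_solution //; case: ltnP => [nk | nk]; first by rewrite ltn_eqF ?leqW.
    have [->|kn1] := eqVneq (k : nat) n.+1; first by rewrite (_ : n.+4 - n.+1 = 3)%N //; lia.
    by rewrite (_ : n.+4 - k = 4)%N //; lia.
rewrite det_two_cols big_nat_recr //= big_nat1 big_nat big1 => [|k /andP[_ kn]].
  rewrite add0r addnn -signr_odd odd_double !eqxx ltn_eqF // mul0r mul1r sub0r mulr1 mulN1r.
  congr (- \det _); apply/matrixP => i j; rewrite !mxE.
  have bumpE : bump n i = i by rewrite /bump leqNgt ltn_ord.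
  by rewrite !bumpE ltn_ord.
rewrite big1 // => l _.
by rewrite (ltn_eqF (leqW kn)) (ltn_eqF kn) mul0r mulr0 subrr mulr0 mul0r.
Qed.

End Expansion.

Lemma det_factor_row_bidiag n (y : 'I_n -> F) (a : F) : (forall i, y i != 0) ->
  \det (\matrix_(k < n, i < n) factor_row y a 0 k i) = a ^+ n * minor2 (even_row y) 0 0.
Proof.
move=> y0.
pose U : 'M[F]_n := \matrix_(k, l)
  ((if l == k :> nat then a else 0) + (if l == k.+1 :> nat then a else 0)).
have <- : \det U = a ^+ n.
  rewrite -det_tr det_trig.
    rewrite -[n in RHS]card_ord -prodr_const; apply: eq_bigr => i _.
    by rewrite !mxE eqxx ltn_eqF // addr0.
  apply/is_trig_mxP => i j ij; rewrite !mxE.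
  by rewrite !ltn_eqF ?addr0 // leqW.
rewrite -det_mulmx; congr (\det _); apply/matrixP => k i; rewrite [RHS]mxE [LHS]mxE.
under eq_bigr => l _ do rewrite !mxE mulrDl.
have pick d : \sum_(l < n) (if l == d :> nat then a else 0) * even_row y l.+2 i
    = if (d < n)%N then a * even_row y d.+2 i else 0.
  rewrite -(big_ord1_eq +%R (fun l => a * even_row y l.+2 i)) [RHS]big_mkcond.
  by apply: eq_bigr => l _; case: eqP; rewrite ?mul0r.
rewrite big_split /= !pick ltn_ord factor_rowE // !mul0r add0r addr0 mulrDr.
congr (_ + _); case: ltnP => // nk.
rewrite (_ : k.+3 = n.+2); last by have := ltn_ord k; lia.
by rewrite /even_row /alt_pow subrr mulr0 subrr mulr0.
Qed.

(** For [b != 0], Laplace expansion of the matrix in [elim_two_cols] along the two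
    solutions gives the coefficients [b^n W] up to sign; [phi] transports the
    identity [psi_wronsk] from [K] to [F]. *)
Lemma det_factor_row (K : fieldType) (phi : {rmorphism K -> F}) n (y : 'I_n -> F) (a b : K) :
  (forall i, y i != 0) ->
  \det (\matrix_(k < n, i < n) factor_row y (phi a) (phi b) k i)
  = \sum_(0 <= p < n.+1) \sum_(0 <= q < (n - p).+1)
      phi (b ^+ p * psi a b q (n - p - q)) * minor2 (even_row y) p (p + q).
Proof.
move=> y0; have [->|b0] := eqVneq b 0.
  rewrite rmorph0 det_factor_row_bidiag // big_nat_recl // [X in _ + X]big1 => [|p _].
    rewrite addr0 big_nat_recl // [X in _ + X]big1 => [|q _].
      by rewrite addr0 addn0 !subn0 psi_bidiag mul1r rmorphXn.
    by rewrite psi_bidiag mulr0 rmorph0 mul0r.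
  by rewrite big1 // => q _; rewrite expr0n mul0r rmorph0 mul0r.
have fb0 : phi b != 0 by rewrite fmorph_eq0.
have phi_sol (u : nat -> K) : (forall m, u m.+5 = - u m - a / b * (u m.+3 + u m.+2)) ->
    forall m, phi b * phi (u m.+5) + phi a * (phi (u m.+3) + phi (u m.+2)) + phi b * phi (u m) = 0.
  move=> uE m; rewrite -rmorphD -!rmorphM -!rmorphD uE -(rmorph0 phi); congr (phi _).
  by field.
apply: (mulfI (_ : -1 != 0 :> F)); first by rewrite oppr_eq0 oner_eq0.
rewrite mulN1r -(@elim_two_cols n y (phi a) (phi b) y0
  (fun m => phi (sol1 a b m)) (fun m => phi (sol2 a b m))).
- rewrite det_two_cols !big_distrr /=; apply: eq_big_nat => p /andP[_ pn].
  rewrite -{1}[p]add0n big_addn -subSn // !big_distrr /=; apply: eq_big_nat => q /andP[_ qn].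
  rewrite psi_wronsk //.
  have -> : (n - p - q).+3 = (n.+4 - (q + p).+1)%N by lia.
  have -> : (n - p - q + q).+4 = (n.+4 - p)%N by lia.
  rewrite (addnC q p) (_ : (-1) ^+ (p + (p + q)) = phi ((-1) ^+ q)); last first.
    by rewrite rmorph_sign addnA addnn exprD -signr_odd odd_double mul1r.
  rewrite -(rmorphXn phi) -!rmorphM -rmorphB.
  rewrite !mulrA -!rmorphM -[-1 in RHS](rmorphN1 phi) -rmorphM; congr (phi _ * _).
  rewrite /wronsk (_ : b ^+ n = b ^+ p * b ^+ q * b ^+ (n - p - q)).
    by rewrite (exprNn b); ring.
  by rewrite -!exprD; congr (_ ^+ _); lia.
- split; last by apply: (phi_sol (sol1 a b)) => m; apply: lin5E.
1-3: by rewrite /sol1 /= ?rmorphN ?rmorph0 ?oppr0.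
- split; last by apply: (phi_sol (sol2 a b)) => m; apply: lin5E.
1-3: by rewrite /sol2 /= ?rmorphN ?rmorph0 ?oppr0.
1-4: by rewrite /sol1 /sol2 /= ?rmorph0 ?rmorph1.
Qed.

End Alternants.

(** * The Weyl denominator and the expansion into characters *)

Section Nonvanishing.
Variables (F : fieldType) (n : nat) (y : 'I_n -> F).
Hypothesis y0 : forall i, y i != 0.
Hypothesis sqr_inj : injective (fun i => y i ^+ 2).
Hypothesis sqr_sep : forall i j, y i ^+ 2 * y j ^+ 2 != 1.

(** A vanishing combination of the columns gives, after multiplication by
    [y^(2n-1)], a nonzero polynomial of degree less than [2n] in [y^2] that
    vanishes at the [2n] distinct points [y_i^2] and [y_i^(-2)]. *)
Lemma weyl_alternant_neq0 : alternant y (weyl_vector2 n) != 0.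
Proof.
rewrite alternant_det -det_tr; apply/det0P => -[v v0 vA].
(* With X = y^2, column j of the alternant times y^(2n-1) is X^(2n-1-j) - X^j. *)
pose p : {poly F} := \sum_(j < n) v 0 j *: ('X^(n + (n - j.+1)) - 'X^j).
have coef_p (j : 'I_n) : p`_(n + (n - j.+1)) = v 0 j.
  rewrite coef_sum (bigD1 j) //= big1 ?addr0 => [|k kj]; rewrite coefZ coefB !coefXn.
    by rewrite eqxx gtn_eqF ?subr0 ?mulr1 //; have := ltn_ord j; lia.
  have kn := ltn_ord k; have jn := ltn_ord j.
  have -> : (n + (n - j.+1) == n + (n - k.+1))%N = false.
    by apply: contraNF kj => /eqP jk; apply/eqP/val_inj; move: jk => /=; lia.
  by rewrite gtn_eqF ?subrr ?mulr0 //; lia.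
have p0 : p != 0.
  apply: contraNneq v0 => p0; apply/eqP/rowP => j.
  by rewrite mxE -coef_p p0 coef0.
have horner_p i z : z = y i \/ z = (y i)^-1 -> p.[z ^+ 2] = 0.
  move=> zE; have z0 : z != 0 by case: zE => ->; rewrite ?invr_eq0.
  rewrite horner_sum.
  have vAz : \sum_j v 0 j * alt_pow z (weyl_vector2 n j 0) = 0.
    have /rowP/(_ i) := vA; rewrite !mxE => vAi.
    case: zE => ->; first by rewrite -[RHS]vAi; apply: eq_bigr => j _; rewrite !mxE.
    rewrite -[RHS]oppr0 -[X in - X]vAi -sumrN; apply: eq_bigr => j _.
    by rewrite !mxE -mulrN -alt_powN /alt_pow -!exprz_inv invrK.
  transitivity (z ^ (n + n).-1%:Z * \sum_j v 0 j * alt_pow z (weyl_vector2 n j 0)); last by rewrite vAz mulr0.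
  rewrite big_distrr /=.
  apply: eq_bigr => j _; have jn := ltn_ord j; rewrite mulrCA hornerZ hornerD hornerN !hornerXn mxE /alt_pow.
  congr (_ * _); rewrite mulrBr -!expfzDr // -!exprM !(exprnP z); congr (z ^ _ - z ^ _); lia.
have size_p : (size p <= n + n)%N.
  apply: (leq_trans (size_sum _ _ _)); apply/bigmax_leqP => j _.
  have jn := ltn_ord j.
  rewrite (leq_trans (size_scale_leq _ _)) // (leq_trans (size_polyD _ _)) //.
  by rewrite size_polyN !size_polyXn; lia.
pose sqs := [seq y i ^+ 2 | i <- enum 'I_n].
pose sqVs := [seq (y i)^-1 ^+ 2 | i <- enum 'I_n].
have : (size (sqs ++ sqVs) < size p)%N.
  apply: max_poly_roots => //.
    rewrite all_cat; apply/andP; split; apply/allP => _ /mapP[i _ ->]; apply/rootP.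
      by apply: (horner_p i); left.
    by apply: (horner_p i); right.
  rewrite cat_uniq; apply/and3P; split.
  - by rewrite map_inj_uniq ?enum_uniq.
  - apply/hasPn => _ /mapP[i _ ->]; apply/mapP => -[j _ ij].
    have := sqr_sep i j; rewrite -ij -exprMn mulfV // expr1n.
    by rewrite eqxx.
  - rewrite map_inj_uniq ?enum_uniq // => i j /=; rewrite !exprVn => /invr_inj.
    exact: sqr_inj.
by rewrite size_cat !size_map -enumT size_enum_ord ltnNge size_p.
Qed.

End Nonvanishing.

(** The row skipped by [minor2] besides [p] is [p + q + 1], so the remaining rows
    carry the exponents [weight531 n p q + weyl_vector2 n]. *)
Lemma prod_factor_ch (K F : fieldType) (phi : {rmorphism K -> F}) n (y : 'I_n -> F) (a b : K) :
  (forall i, y i != 0) -> alternant y (weyl_vector2 n) != 0 ->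
  \prod_(i < n) factor (phi a) (phi b) (y i)
  = \sum_(0 <= p < n.+1) \sum_(0 <= q < (n - p).+1)
      phi (b ^+ p * psi a b q (n - p - q)) * ch_SO_odd y (weight531 n p q).
Proof.
move=> y0 D0; apply: (mulIf D0).
have -> : (\prod_(i < n) factor (phi a) (phi b) (y i)) * alternant y (weyl_vector2 n)
    = \det (\matrix_(k < n, i < n) factor_row y (phi a) (phi b) k i).
  rewrite alternant_det -det_tr.
  transitivity (\det (diag_mx (\row_i factor (phi a) (phi b) (y i)) *m
      \matrix_(i, j) alt_pow (y i) (weyl_vector2 n j 0))).
    by rewrite det_mulmx det_diag det_tr; congr (_ * _); apply: eq_bigr => i _; rewrite mxE.
  rewrite -[RHS]det_tr; congr (\det _); apply/matrixP => i k.
  by rewrite mul_diag_mx !mxE.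
rewrite det_factor_row // mulr_suml; apply: eq_big_nat => p /andP[_ pn].
rewrite mulr_suml; apply: eq_big_nat => q /andP[_ qn].
rewrite /ch_SO_odd -mulrA divfK //; congr (_ * _).
rewrite alternant_det -det_tr; congr (\det _); apply/matrixP => i j; rewrite !mxE /even_row.
congr alt_pow; have := ltn_ord i.
have -> : bump p (bump (p + q) i) = if (i < p)%N then (i : nat) else if (i < p + q)%N then i.+1 else i.+2.
  by rewrite /bump; case: ltnP => ip; [|case: ltnP => ipq]; lia.
by do 2?case: ifP => _; lia.
Qed.

Theorem theoremA1 (K : fieldType) (n : nat) (hn : (1 <= n)%N) (a1 a5 : K) :
  \prod_(i < n)
     (cst n a1 * (sqrtx K i + (sqrtx K i)^-1)
      + cst n a5 * (sqrtx K i ^+ 5 + sqrtx K i ^- 5))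
  = \sum_(0 <= p < n.+1) \sum_(0 <= q < (n - p).+1)
      cst n (a5 ^+ p * psi a1 a5 q (n - p - q))
      * ch_SO_odd (@sqrtx K n) (weight531 n p q).
Proof.
pose phi : {rmorphism K -> ratfun K n} := @tofrac {mpoly K[n]} \o @mpolyC n K.
have sqrtx_neq0 i : sqrtx K i != 0 :> ratfun K n.
  rewrite /sqrtx tofrac_eq0; apply/eqP => /(congr1 (meval (fun=> 1))).
  by rewrite mevalXU meval0; apply/eqP/oner_neq0.
(* The squares are separated by evaluation at a unit vector, and the products of
   squares from 1 by evaluation at 0. *)
have sqr_inj : injective (fun i => sqrtx K i ^+ 2 : ratfun K n).
  move=> i j /=; rewrite /sqrtx -!tofracXn => /eqP; rewrite tofrac_eq => /eqP.
  move/(congr1 (meval (fun k => (k == i)%:R))).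
  rewrite !rmorphXn /= !mevalXU eqxx expr1n.
  by case: eqP => // _ /eqP; rewrite expr0n oner_eq0.
have sqr_sep i j : sqrtx K i ^+ 2 * sqrtx K j ^+ 2 != 1 :> ratfun K n.
  rewrite /sqrtx -!tofracXn -tofracM -tofrac1 tofrac_eq.
  apply/eqP => /(congr1 (meval (fun=> 0))).
  rewrite rmorphM !rmorphXn rmorph1 /= !mevalXU expr0n mul0r => /eqP.
  by rewrite eq_sym oner_eq0.
have den_neq0 := weyl_alternant_neq0 sqrtx_neq0 sqr_inj sqr_sep.
transitivity (\prod_(i < n) factor (phi a1) (phi a5) (sqrtx K i)).
  by apply: eq_bigr => i _.
rewrite (prod_factor_ch phi _ _ sqrtx_neq0 den_neq0).
by apply: eq_bigr => p _; apply: eq_bigr => q _.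
Qed.
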